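(* Let $f$ satisfy Assumption A with constant $b>0$, let $(\chi_n)_{n\ge 1}$ satisfy Assumption B, let $x^*\in (f(0),f(b))$ be an arbitrary point, and let $\nu=\nu(x^* )=\Phi(f^{-1}(x^* ))$. Put $g(x):=f(\nu x)$ for $x\ge0$ and $c:=b/\nu$. Let $d>0$ satisfy $$d<\min\Big\{c-g(c),\ \max_{x\in[0,x^*]}[g(x)-x]\Big\},$$ and define $$y_1:=\sup\{x\in[0,x^*]: g(x)-x\ge d\},\qquad y_2:=\inf\{x\in[x^*,c]: g(x)-x\le -d\}.$$ Let $0<\ell\le d$, let $x_0>0$ be arbitrary, and let $(x_n)$ be the solution of $$x_{n+1}=\max\{f(\nu x_n)+\ell\chi_{n+1},\,0\},\qquad n=0,1,2,\dots,$$ with initial value $x_0$. Then: (i) for each $\varepsilon>0$ there exists a random, almost surely finite, $\mathcal N(\omega)=\mathcal N(\omega,x_0,\ell,x^*,\varepsilon)$ such that, almost surely, $y_1\le x_n\le y_2+\varepsilon$ for all $n\ge\mathcal N(\omega)$; (ii) for each $\varepsilon>0$ and each $\gamma\in(0,1)$ there exists a nonrandom $N=N(\gamma,x_0,\ell,x^*,\varepsilon)$ such that $$\mathbb P\{y_1\le x_n\le y_2+\varepsilon\ \text{ for all } n\ge N\}>\gamma;$$ (iii) $\displaystyle\liminf_{n\to\infty}x_n\ge y_1$ and $\displaystyle\limsup_{n\to\infty}x_n\le y_2$ almost surely.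
   Context: Assumption A (on $f$ and $b$): $f:[0,\infty)\to[0,\infty)$ is continuous, and $b>0$ is a real number such that $f$ is strictly increasing on $(0,b]$, $f(x)/x$ is strictly decreasing on $(0,b]$, $f(b)>b$, and $f(b)/b>f(x)/x$ for all $x\in(b,\infty)$. Assumption B (on the noise): on a complete probability space $(\Omega,\mathcal F,\mathbb P)$, $(\chi_n)_{n\ge1}$ is a sequence of independent identically distributed random variables with zero mean, having a density $\phi$ with $\phi(x)>0$ for $x\in[-1,1]$ and $\phi(x)=0$ for $x\notin[-1,1]$. Notation: $f^{-1}:[f(0),f(b)]\to[0,b]$ is the inverse of the restriction of $f$ to $[0,b]$. $\Phi(z):=z/f(z)$ for $z\in(0,b]$. *)

(* Defs.v *)
From HB Require Import structures.
From mathcomp Require Import all_boot all_order all_algebra.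
From mathcomp Require Import all_classical all_reals all_analysis.
From mathcomp Require Import measurable_realfun.

Set Implicit Arguments.
Unset Strict Implicit.
Unset Printing Implicit Defensive.

Import Order.TTheory GRing.Theory Num.Theory.
Import numFieldNormedType.Exports.

Local Open Scope classical_set_scope.
Local Open Scope ring_scope.

(* The map [0, oo) -> [0, oo) is encoded by a total f : R -> R of which only
   the values on [0, oo) are constrained (and used). *)
Record map_assumption (R : realType) (f : R -> R) (b : R) : Prop := {
  map_continuous : {within `[0, +oo[, continuous f};
  map_ge0 : forall x, 0 <= x -> 0 <= f x;
  map_b_gt0 : 0 < b;
  map_increasing : {in `]0, b] &, {homo f : x y / x < y}};
  map_ratio_decreasing :
    {in `]0, b] &, {homo (fun x => f x / x) : x y /~ x < y}};
  map_b_lt : b < f b;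
  map_ratio_tail : forall x, b < x -> f x / x < f b / b
}.

(* Partial inverse of f restricted to [0, b]; when f is injective on [0, b] it
   is the inverse on f([0, b]), and it is 0 outside of f([0, b]). *)
Definition inv_on (R : realType) (f : R -> R) (b : R) : R -> R :=
  'pinv_(fun=> 0) `[0, b] f.

Definition Phi (R : realType) (f : R -> R) (z : R) : R := z / f z.

(* Maximum over a segment, as a supremum; see max_overP. *)
Definition max_over (R : realType) (h : R -> R) (a b : R) : R :=
  sup (h @` `[a, b]).

Lemma max_overP (R : realType) (h : R -> R) (a b : R) :
  a <= b -> {within `[a, b], continuous h} ->
  (exists2 t, t \in `[a, b] & h t = max_over h a b) /\
  (forall t, t \in `[a, b] -> h t <= max_over h a b).
Proof.
move=> ab ch; have [t tab ht] := EVT_max ab ch.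
suff E : h t = max_over h a b by split; [exists t|move=> s /ht; rewrite -E].
apply/eqP; rewrite eq_le; apply/andP; split.
- by apply: ub_le_sup; [exists (h t) => _ [s /= /ht hs <-]|exists t].
- by apply: ge_sup; [exists (h t); exists t|move=> _ [s /= /ht hs <-]].
Qed.

Definition mutually_independent (I : choiceType) (d : measure_display)
    (T : measurableType d) (R : realType) (P : probability T R)
    (X : I -> {RV P >-> R}) : Prop :=
  forall (J : seq I) (B : I -> set R),
    uniq J -> (forall i, measurable (B i)) ->
    P (\bigcap_(i in [set` J]) X i @^-1` B i) =
    (\prod_(i <- J) P (X i @^-1` B i))%E.

Definition identically_distributed (I : Type) (d : measure_display)
    (T : measurableType d) (R : realType) (P : probability T R)
    (X : I -> {RV P >-> R}) : Prop :=
  forall (i j : I) (A : set R), measurable A ->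
    distribution P (X i) A = distribution P (X j) A.

Definition is_density (d : measure_display) (T : measurableType d)
    (R : realType) (P : probability T R) (X : {RV P >-> R})
    (phi : R -> R) : Prop :=
  [/\ measurable_fun setT phi,
      forall x, 0 <= phi x &
      forall A : set R, measurable A ->
        distribution P X A = (\int[lebesgue_measure]_(x in A) (phi x)%:E)%E].

Record noise_assumption (d : measure_display) (T : measurableType d)
    (R : realType) (P : probability T R) (X : nat -> {RV P >-> R}) : Prop := {
  noise_complete : measure_is_complete P;
  noise_independent : mutually_independent X;
  noise_identically_distributed : identically_distributed X;
  noise_mean0 : forall n, 'E_P[X n]%E = 0%E;
  noise_density : exists phi : R -> R,
    [/\ forall n, is_density (X n) phi,
        forall x, x \in `[-1, 1] -> 0 < phi x &
        forall x, x \notin `[-1, 1] -> phi x = 0]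
}.

(* A random variable with values in {0, 1, 2, ...} \cup {+oo}. *)
Definition random_index (d : measure_display) (T : measurableType d)
    (R : realType) (N : T -> \bar R) : Prop :=
  measurable_fun setT N /\
  forall w, N w = +oo%E \/ exists k : nat, N w = k%:R%:E.

(* Main.v *)
(* The point xs is fixed by g, which is nondecreasing on [0, c], while g x / x
   decreases there. Above y2 the ratio is at most 1 - d / y2, so with noise at
   most d the excess of x_n over y2 contracts geometrically: from some
   time on, x_n <= min (y2 + eps) c. Below c, the half-line above y1 is absorbing
   because g x >= y1 + d there, and below y1 one has g x >= x, so a run of K
   noises larger than 1/2 lifts x_n over y1 as soon as K l / 2 >= y1. Such runs
   occur infinitely often almost surely by independence. *)

Require Import Defs.
From HB Require Import structures.
From mathcomp Require Import all_boot all_order all_algebra.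
From mathcomp Require Import all_classical all_reals all_analysis.
From mathcomp Require Import measurable_realfun.
From mathcomp Require Import ring lra zify.

Import Order.TTheory GRing.Theory Num.Theory.
Import numFieldNormedType.Exports.

Local Open Scope classical_set_scope.
Local Open Scope ring_scope.

Set Implicit Arguments.
Unset Strict Implicit.
Unset Printing Implicit Defensive.

(** * Monotonicity of the map and of its ratio, and the partial inverse *)

(** Strict increase is assumed on []0, b]] only; the endpoint 0 is added by continuity, [f 0] being
    the right limit of values that are eventually at most [f y]. *)
Lemma map_nondecreasing (R : realType) (f : R -> R) (b : R) :
  map_assumption f b -> {in `[0, b] &, {homo f : x y / x <= y}}.
Proof.
move=> [fc _ b0 finc _ _ _] x y; rewrite !in_itv /= => /andP[x0 xb] /andP[y0 yb].
have pos u v : 0 < u -> u <= v -> v <= b -> f u <= f v.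
  move=> u0; rewrite le_eqVlt => /predU1P[->//|uv vb]; apply/ltW/finc => //.
    by rewrite in_itv /= u0 (le_trans (ltW uv) vb).
  by rewrite in_itv /= vb (lt_trans u0 uv).
rewrite le_eqVlt => /predU1P[->//|xy].
move: x0; rewrite le_eqVlt => /predU1P[x0|x0]; last by apply: pos => //; exact: ltW.
subst x.
have /continuous_within_itvcyP[_ f0r] := fc.
rewrite -(cvg_lim _ f0r)//; apply: limr_le; first by apply/cvg_ex; exists (f 0).
near=> t; apply: pos => //; near: t.
by apply: filterS (nbhs_right_lt xy) => t /ltW.
Unshelve. all: by end_near.
Qed.

(** The decrease on []0, b]] and the tail condition are chained through the value [f b / b]. *)
Lemma map_ratio_lt (R : realType) (f : R -> R) (b : R) :
  map_assumption f b -> forall x y, 0 < x -> x < y -> x <= b ->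
  f y / y < f x / x.
Proof.
move=> [_ _ b0 _ fr _ ft] x y x0 xy xb.
have [yb|by_] := leP y b.
  by apply: fr; rewrite // in_itv /= ?x0 ?xb ?yb ?(lt_trans x0 xy).
apply: (lt_le_trans (ft _ by_)).
move: xb; rewrite le_eqVlt => /predU1P[->//|xb]; apply/ltW/fr => //.
  by rewrite in_itv /= b0 lexx.
by rewrite in_itv /= x0 ltW.
Qed.

(** The intermediate value theorem puts [xs] in the image of [[0, b]], so the partial inverse does
    not take its default value; both endpoints are excluded because [xs] differs from [f 0] and
    [f b]. *)
Lemma inv_onP (R : realType) (f : R -> R) (b xs : R) :
  map_assumption f b -> xs \in `]f 0, f b[ ->
  0 < inv_on f b xs < b /\ f (inv_on f b xs) = xs.
Proof.
move=> hf; rewrite in_itv /= => /andP[xs0 xsb]; have [fc f0 b0 _ _ _ _] := hf.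
have im : [set f x | x in `[0, b]] xs.
  have fcb : {within `[0, b], continuous f}.
    apply: continuous_subspaceW fc => t /=; rewrite !in_itv /= => /andP[->].
    by rewrite andbT.
  have [|z zb fz] := IVT (ltW b0) fcb (v := xs).
    by rewrite ge_min le_max (ltW xs0) (ltW xsb) orbT.
  by exists z.
have fz : f (inv_on f b xs) = xs by apply: pinvK; rewrite inE.
split=> //.
have : `[0, b]%classic (inv_on f b xs).
  by apply: (@surjpinv_image_sub _ _ _ _ _ f (@subset_refl _ _)); exists xs.
rewrite /= in_itv /= !le_eqVlt => /andP[/predU1P[z0|->]].
  by move: xs0; rewrite -fz -z0 ltxx.
by move=> /predU1P[zb|//]; move: xsb; rewrite -fz zb ltxx.
Qed.

(** * The rescaled map and the thresholds [y1] and [y2] *)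

(* The properties of [g x = f (nu x)] on which the dynamics depends: [xs] is a
   fixed point, and [g x / x] decreases up to [c] and stays below afterwards. *)
Record rescaled_map (R : realType) (g : R -> R) (xs c : R) : Prop := {
  rescaled_ge0 : forall x, 0 <= x -> 0 <= g x;
  rescaled_nondecreasing : forall x y, 0 <= x -> x <= y -> y <= c -> g x <= g y;
  rescaled_ratio : forall x y, 0 < x -> x <= y -> x <= c -> g y * x <= g x * y;
  rescaled_fixpoint : g xs = xs;
  rescaled_fixpoint_gt0 : 0 < xs;
  rescaled_fixpoint_lt : xs < c
}.

(** With [z = inv_on f b xs] one has [f z = xs], hence [nu = z / xs] and [nu * xs = z]: this choice
    of [nu] is what makes [xs] a fixed point. *)
Lemma rescaled_mapP (R : realType) (f : R -> R) (b xs : R) :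
  map_assumption f b -> xs \in `]f 0, f b[ ->
  let nu := Phi f (inv_on f b xs) in
  0 < nu /\ rescaled_map (fun x => f (nu * x)) xs (b / nu).
Proof.
move=> hf hxs nu; have [/andP[z0 zb] fz] := inv_onP hf hxs.
have [_ f0 _ _ _ _ _] := hf.
have xs0 : 0 < xs.
  by move: hxs; rewrite in_itv /= => /andP[+ _]; apply: le_lt_trans; exact: f0.
have nu0 : 0 < nu by rewrite /nu /Phi fz divr_gt0.
have nuxs : nu * xs = inv_on f b xs by rewrite /nu /Phi fz divfK ?gt_eqF.
clearbody nu.
have leb x : x <= b / nu -> nu * x <= b by rewrite ler_pdivlMr// mulrC.
split=> //; split=> //.
- by move=> x x0; apply: f0; rewrite mulr_ge0// ltW.
- move=> x y x0 xy yc; have y0 := le_trans x0 xy.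
  apply: (map_nondecreasing hf); rewrite ?in_itv /=.
  + by rewrite mulr_ge0 ?leb ?(le_trans xy)// ltW.
  + by rewrite mulr_ge0 ?leb// ltW.
  + by rewrite ler_wpM2l// ltW.
- move=> x y x0; rewrite le_eqVlt => /predU1P[->//|xy] xc.
  have y0 := lt_trans x0 xy.
  have nxy : nu * x < nu * y by rewrite ltr_pM2l.
  have /ltW := map_ratio_lt hf (mulr_gt0 nu0 x0) nxy (leb _ xc).
  rewrite ler_pdivrMr ?mulr_gt0// -mulrA invfM mulrACA mulVf ?gt_eqF// mul1r.
  by rewrite mulrA mulrAC ler_pdivlMr.
- by rewrite nuxs.
- by rewrite ltr_pdivlMr// mulrC nuxs.
Qed.

(* Taking [s = max xs (g c + d)] avoids any appeal to the continuity of [g]. *)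
Lemma upper_bound_lt (R : realType) (g : R -> R) (xs c d : R) :
  rescaled_map g xs c -> d < c - g c ->
  inf [set x | x \in `[xs, c] /\ g x - x <= - d] < c.
Proof.
move=> [_ ginc _ _ xs0 xsc] dc; set S := [set x | _].
pose s := Num.max xs (g c + d).
have sc : s < c by rewrite gt_max xsc /=; lra.
have xss : xs <= s by rewrite le_max lexx.
apply: (le_lt_trans _ sc); apply: ge_inf.
  by exists xs => t [] /=; rewrite in_itv /= => /andP[].
split; first by rewrite in_itv /= xss ltW.
have gs : g s <= g c by apply: ginc => //; lra.
have : g c + d <= s by rewrite le_max lexx orbT.
lra.
Qed.

(** Below the fixed point the ratio [g x / x] is at least its value 1 at [xs]. For the last bound,
    every [t] in the set has [t + d <= g t <= g x], and this passes to the supremum without its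
    being attained. *)
Lemma lower_boundP (R : realType) (g : R -> R) (xs c d : R) :
  rescaled_map g xs c -> d < max_over (fun x => g x - x) 0 xs ->
  let y1 := sup [set x | x \in `[0, xs] /\ d <= g x - x] in
  [/\ 0 <= y1 <= xs,
      forall x, 0 <= x -> x <= y1 -> x <= g x &
      forall x, y1 <= x -> x <= c -> y1 + d <= g x].
Proof.
move=> [g0 ginc gr gxs xs0 xsc] dM; set S := [set x | _] => y1.
(* As [d] is below the maximum, the set is nonempty and [y1] is a genuine supremum. *)
have [s Ss] : S !=set0.
  have [|_ [s /= sxs <-] ds] := sup_gt _ dM.
    by exists (g 0 - 0); exists 0 => //=; rewrite in_itv /= lexx ltW.
  by exists s; split=> //; exact: ltW.
have ubS : ubound S xs by move=> t [] /=; rewrite in_itv /= => /andP[].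
have y1xs : y1 <= xs by apply: ge_sup => //; exists s.
have ley1 t : S t -> t <= y1 by move=> St; apply: ub_le_sup => //; exists xs.
split.
- rewrite y1xs andbT; apply: le_trans (ley1 _ Ss).
  by case: Ss; rewrite in_itv /= => /andP[].
- move=> x; rewrite le_eqVlt => /predU1P[<- _|x0 xy1]; first exact: g0.
  have xxs := le_trans xy1 y1xs.
  have := gr x xs x0 xxs (le_trans xxs (ltW xsc)).
  by rewrite gxs [X in X <= _]mulrC ler_pM2r.
- move=> x y1x xc; rewrite -lerBrDr; apply: ge_sup; first by exists s.
  move=> t St; have tx := le_trans (ley1 _ St) y1x.
  case: St; rewrite in_itv /= => /andP[t0 _] dt.
  by have := ginc _ _ t0 tx xc; lra.
Qed.

(** For [x <= y2], every [t] in the set has [g x <= g t <= t - d], which passes to the infimum.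
    Applied at [y2], this bounds the ratio there by [(y2 - d) / y2], and the ratio is no larger
    further right. *)
Lemma upper_boundP (R : realType) (g : R -> R) (xs c d : R) :
  rescaled_map g xs c -> d < c - g c ->
  let y2 := inf [set x | x \in `[xs, c] /\ g x - x <= - d] in
  [/\ xs <= y2,
      forall x, 0 <= x -> x <= y2 -> g x <= y2 - d &
      forall x, y2 <= x -> g x * y2 <= (y2 - d) * x].
Proof.
move=> hg dc; have := upper_bound_lt hg dc; case: hg.
move=> g0 ginc gr gxs xs0 xsc; set S := [set x | _] => y2c y2.
have Sc : S c by split; [rewrite in_itv /= lexx ltW|lra].
have xsy2 : xs <= y2.
  apply: lb_le_inf; first by exists c.
  by move=> t [] /=; rewrite in_itv /= => /andP[].
have gy2 x : 0 <= x -> x <= y2 -> g x <= y2 - d.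
  move=> x0 xy2; rewrite lerBrDr; apply: lb_le_inf; first by exists c.
  move=> t St; have xt : x <= t.
    apply: (le_trans xy2); apply: ge_inf => //.
    by exists xs => u [] /=; rewrite in_itv /= => /andP[].
  case: St; rewrite in_itv /= => /andP[_ tc] dt.
  by have := ginc _ _ x0 xt tc; lra.
have y20 := lt_le_trans xs0 xsy2.
split=> // x y2x; apply: (le_trans (gr _ _ y20 y2x (ltW y2c))).
by rewrite ler_wpM2r ?gy2 ?(le_trans _ y2x)// ltW.
Qed.

(** * Pathwise trapping of orbits *)

Lemma orbit_upper_trapped (R : realType) (g : R -> R) (xs c d l : R)
    (e u : nat -> R) :
  rescaled_map g xs c -> 0 < d -> d < c - g c -> 0 < l -> l <= d ->
  (forall n, 0 <= u n) ->
  (forall n, u n.+1 = Num.max (g (u n) + l * e n.+1) 0) ->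
  (forall n, e n.+1 <= 1) ->
  let y2 := inf [set x | x \in `[xs, c] /\ g x - x <= - d] in
  forall eps, 0 < eps ->
  exists N, forall n, (N <= n)%N -> u n <= y2 + eps.
Proof.
move=> hg d0 dc l0 ld u0 uS e1 y2 eps eps0.
have [xsy2 gle glin] := upper_boundP hg dc; rewrite -/y2 in xsy2 gle glin.
have [g0 _ _ _ xs0 _] := hg.
have y20 := lt_le_trans xs0 xsy2.
(* Since [0 <= g y2 <= y2 - d]; this makes the contraction factor [q] nonnegative. *)
have dy2 : d <= y2.
  by rewrite -subr_ge0; apply: le_trans (gle _ (ltW y20) (lexx _)); apply/g0/ltW.
pose q := 1 - d / y2; pose v n := Num.max (u n - y2) 0.
have v0 n : 0 <= v n by rewrite /v le_max lexx orbT.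
have q0 : 0 <= q by rewrite subr_ge0 ler_pdivrMr ?mul1r.
have q1 : q < 1 by rewrite ltrBlDr ltrDl divr_gt0.
have qy2 : q * y2 = y2 - d by rewrite /q mulrBl mul1r divfK ?gt_eqF.
have le1 n : l * e n.+1 <= d.
  by rewrite (le_trans _ ld)// -[leRHS]mulr1 ler_wpM2l// ltW.
(* Below [y2] the map leaves room [d] for the noise, so the next excess is 0. Above [y2],
   [g (u n) <= q * u n], and [q * y2 = y2 - d] turns the bound [q * u n + d - y2] into
   [q * (u n - y2)]. *)
have vS n : v n.+1 <= q * v n.
  rewrite {1}/v ge_max mulr_ge0// andbT uS; have := le1 n.
  have [uy|uy] := leP (u n) y2.
    have := gle _ (u0 n) uy.
    have : 0 <= q * v n by rewrite mulr_ge0.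
    by case: (leP (g (u n) + l * e n.+1) 0); lra.
  have -> : v n = u n - y2 by rewrite /v max_l// subr_ge0 ltW.
  have : g (u n) <= q * u n.
    rewrite -(ler_pM2r y20); apply: le_trans (glin _ (ltW uy)) _.
    by rewrite mulrAC qy2.
  have : 0 <= q * (u n - y2) by rewrite mulr_ge0// subr_ge0 ltW.
  by case: (leP (g (u n) + l * e n.+1) 0); lra.
have vq n : v n <= q ^+ n * v 0%N.
  elim: n => [|n ih]; first by rewrite expr0 mul1r.
  by rewrite (le_trans (vS n))// exprS -mulrA ler_wpM2l.
have : (q ^+ n * v 0%N) @[n --> \oo] --> (0 : R).
  rewrite -[X in _ --> X](mul0r (v 0%N)); apply: cvgM; last exact: cvg_cst.
  by apply: cvg_expr; rewrite ger0_norm.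
move=> /cvgr0_norm_lt /(_ _ eps0)[N _ hN]; exists N => n /hN /= small.
have : v n < eps by rewrite (le_lt_trans (vq n))// (le_lt_trans (ler_norm _)).
by rewrite gt_max => /andP[+ _]; lra.
Qed.

Lemma orbit_lower_trapped (R : realType) (g : R -> R) (xs c d l : R)
    (e u : nat -> R) (K : nat) :
  rescaled_map g xs c -> d < max_over (fun x => g x - x) 0 xs ->
  0 < l -> l <= d ->
  (forall n, 0 <= u n) ->
  (forall n, u n.+1 = Num.max (g (u n) + l * e n.+1) 0) ->
  (forall n, - 1 <= e n.+1) ->
  let y1 := sup [set x | x \in `[0, xs] /\ d <= g x - x] in
  y1 <= K%:R * (l / 2) ->
  forall j, (forall n, (j <= n)%N -> u n <= c) ->
  (forall i, (i < K)%N -> 1 / 2 < e (j + i).+1) ->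
  forall n, (j + K <= n)%N -> y1 <= u n.
Proof.
move=> hg dM l0 ld u0 uS e1 y1 y1K j uc erun.
have [/andP[y10 _] gx gy1] := lower_boundP hg dM; rewrite -/y1 in y10 gx gy1.
have leu n : g (u n) + l * e n.+1 <= u n.+1 by rewrite uS le_max lexx.
(* The map lifts the orbit to at least [y1 + d], and the noise takes away at most [l <= d]. *)
have stay n : (j <= n)%N -> y1 <= u n -> y1 <= u n.+1.
  move=> jn yu; apply: le_trans (leu n).
  have := gy1 _ yu (uc n jn).
  have : - l <= l * e n.+1 by rewrite -mulrN1 ler_wpM2l// ltW.
  lra.
(* During the run, each step that starts below [y1] gains at least [l / 2]; an orbit already above
   [y1] stays there. *)
have climb i : (i <= K)%N -> y1 <= u (j + i)%N \/ i%:R * (l / 2) <= u (j + i)%N.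
  elim: i => [_|i ih iK]; first by right; rewrite mul0r.
  rewrite addnS; case: (leP y1 (u (j + i)%N)) => [yu|uy].
    by left; apply: stay => //; rewrite leq_addr.
  case: (ih (ltnW iK)) => [|iu]; first by rewrite leNgt uy.
  right; apply: le_trans (leu _).
  have := gx _ (u0 _) (ltW uy).
  have : l * (1 / 2) <= l * e (j + i).+1 by rewrite ler_wpM2l ?ltW// erun.
  by rewrite -(natr1 i) mulrDl mul1r; lra.
move=> n; elim: n => [|n ih].
  rewrite leqn0 addn_eq0 => /andP[/eqP j0 /eqP K0].
  by case: (climb K (leqnn K)); rewrite j0 K0 addn0 //; move: y1K; rewrite K0; lra.
rewrite leq_eqVlt => /predU1P[<-|jn].
  by case: (climb K (leqnn K)) => //; exact: le_trans.
by apply: stay; [lia|exact: ih].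
Qed.

(** The upper bound serves twice: with margin [c - y2] it keeps the orbit below [c], where a later
    run can lift it over [y1], and with margin [eps] it gives the final bound. *)
Lemma orbit_trapped (R : realType) (g : R -> R) (xs c d l : R)
    (e u : nat -> R) (K : nat) :
  rescaled_map g xs c -> 0 < d -> d < c - g c ->
  d < max_over (fun x => g x - x) 0 xs -> 0 < l -> l <= d ->
  (forall n, 0 <= u n) ->
  (forall n, u n.+1 = Num.max (g (u n) + l * e n.+1) 0) ->
  (forall n, - 1 <= e n.+1 <= 1) ->
  let y1 := sup [set x | x \in `[0, xs] /\ d <= g x - x] in
  let y2 := inf [set x | x \in `[xs, c] /\ g x - x <= - d] in
  y1 <= K%:R * (l / 2) ->
  (forall m, exists2 j, (m <= j)%N &
     forall i, (i < K)%N -> 1 / 2 < e (j + i).+1) ->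
  forall eps, 0 < eps ->
  exists N, forall n, (N <= n)%N -> y1 <= u n <= y2 + eps.
Proof.
move=> hg d0 dc dM l0 ld u0 uS e1 y1 y2 y1K runs eps eps0.
have up := orbit_upper_trapped hg d0 dc l0 ld u0 uS.
have {}up := up (fun n => proj2 (andP (e1 n))).
have y2c : 0 < c - y2 by rewrite subr_gt0; exact: upper_bound_lt.
have [m hm] := up _ y2c; have [m' hm'] := up _ eps0.
have [j mj hj] := runs m.
have lo : forall n, (j + K <= n)%N -> y1 <= u n.
  apply: (orbit_lower_trapped hg dM l0 ld u0 uS) => //.
    by move=> n; case/andP: (e1 n).
  move=> n jn; have := hm n (leq_trans mj jn).
  by rewrite -/y2; lra.
exists (maxn m' (j + K)) => n; rewrite geq_max => /andP[m'n jn].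
by rewrite lo// hm'.
Qed.

(** * Almost sure occurrence of long runs *)

(** The product rule is given only for intersections of the [H i], so complements are removed one
    block at a time by subtraction. The extra indices [J], lying beyond all the blocks, make the
    induction go through: the removed block is appended to [J]. *)
Lemma probability_no_run d (T : measurableType d) (R : realType)
    (P : probability T R) (H : nat -> set T) (p : R) (m K : nat) :
  (forall i, measurable (H i)) ->
  (forall J : seq nat, uniq J ->
     P (\bigcap_(i in [set` J]) H i) = (p ^+ size J)%:E) ->
  forall (L : nat) (J : seq nat), uniq J ->
  (forall i, i \in J -> (m + L * K <= i)%N) ->
  P (\big[setI/setT]_(j < L) ~` (\bigcap_(i in [set` iota (m + j * K) K]) H i)
       `&` \bigcap_(i in [set` J]) H i) =
  ((1 - p ^+ K) ^+ L * p ^+ size J)%:E.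
Proof.
move=> mH PH.
have mcap (J : seq nat) : measurable (\bigcap_(i in [set` J]) H i).
  exact: bigcap_measurableType.
elim=> [|L ih] J uJ lbJ; first by rewrite big_ord0 setTI expr0 mul1r PH.
rewrite big_ord_recr /=; set D := \big[_/_]_(_ < _) _; set A := bigcap _ _.
set C := bigcap _ _.
have mD : measurable D by apply: bigsetI_measurable => i _; exact: measurableC.
have mC : measurable C by exact: mcap.
have mA : measurable A by exact: mcap.
transitivity (P (D `&` C) - P (D `&` C `&` A))%E.
  rewrite setIAC -setDE; apply: measureD => //; first exact: measurableI.
  by rewrite (le_lt_trans (probability_le1 _ _)) ?ltry//; exact: measurableI.
have -> : P (D `&` C) = ((1 - p ^+ K) ^+ L * p ^+ size J)%:E.
  by apply: ih => // i /lbJ; lia.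
have -> : P (D `&` C `&` A) = ((1 - p ^+ K) ^+ L * p ^+ (size J + K))%:E.
  rewrite -setIA; have -> : C `&` A =
      \bigcap_(i in [set` J ++ iota (m + L * K) K]) H i.
    by rewrite bigcap_seq big_cat -!bigcap_seq.
  rewrite -[X in (size J + X)%N](size_iota (m + L * K) K) -size_cat; apply: ih.
    rewrite cat_uniq uJ iota_uniq andbT /=; apply/hasPn => i.
    by rewrite mem_iota => /andP[_ iL]; apply/negP => /lbJ; lia.
  by move=> i; rewrite mem_cat mem_iota => /orP[/lbJ|/andP[]//]; lia.
by rewrite -EFinB exprD exprSr; congr EFin; ring.
Qed.

(* Disjoint blocks of length [K] are all successful with the same positive
   probability, so almost surely one of them is. *)
Lemma ae_runs d (T : measurableType d) (R : realType)
    (P : probability T R) (H : nat -> set T) (p : R) (K : nat) :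
  (forall i, measurable (H i)) -> 0 < p ->
  (forall J : seq nat, uniq J ->
     P (\bigcap_(i in [set` J]) H i) = (p ^+ size J)%:E) ->
  {ae P, forall w, forall m, exists2 j, (m <= j)%N &
     forall i, (i < K)%N -> H (j + i)%N w}.
Proof.
move=> mH p0 PH; apply: ae_foralln => m.
pose D L := \big[setI/setT]_(j < L) ~` (\bigcap_(i in [set` iota (m + j * K) K]) H i).
have DE L : D L = \bigcap_(j < L) ~` (\bigcap_(i in [set` iota (m + j * K) K]) H i).
  by rewrite bigcap_mkord.
have mD L : measurable (D L).
  by apply: bigsetI_measurable => i _; apply/measurableC/bigcap_measurableType.
have PD L : P (D L) = ((1 - p ^+ K) ^+ L)%:E.
  have := @probability_no_run _ _ _ P H p m K mH PH L [::].
  by rewrite set_nil bigcap_set0 setIT mulr1; apply.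
have p1 : p <= 1.
  rewrite -lee_fin -[p]expr1 -(PH [:: 0%N])//; apply: probability_le1.
  exact: bigcap_measurableType.
exists (\bigcap_L D L); split.
- exact: bigcap_measurableType.
- apply/eqP; rewrite eq_le measure_ge0 andbT.
  have cv : ((1 - p ^+ K) ^+ L) @[L --> \oo] --> (0 : R).
    apply: cvg_expr; rewrite ger0_norm; last by rewrite subr_ge0 exprn_ile1// ltW.
    by rewrite ltrBlDr ltrDl exprn_gt0.
  (* The event that every block fails lies in each [D L], whose probability [(1 - p ^+ K) ^+ L]
     tends to 0. *)
  apply/lee_addgt0Pr => eps eps0; rewrite add0e.
  have [L _ /(_ L (leqnn L)) /= rL] := cvgr0_norm_lt _ cv _ eps0.
  apply: (@le_trans _ _ (P (D L))).
    by rewrite le_measure ?inE//; [exact: bigcap_measurableType|exact: bigcap_inf].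
  by rewrite PD lee_fin ltW// (le_lt_trans (ler_norm _)).
- move=> w /= nrun L _; rewrite DE => j /= jL run; apply: nrun.
  exists (m + j * K)%N; first exact: leq_addr.
  by move=> i iK; apply: run; rewrite /= mem_iota leq_addr ltn_add2l.
Qed.

(** * First index at which an event occurs *)

(** [N w] is the least [k] with [F k w], and [+oo] if there is none. It is measurable because its
    level sets are the disjointified events [seqDU F k] and the complement of their union. *)
Lemma random_index_exists d (T : measurableType d) (R : realType)
    (F : nat -> set T) : (forall k, measurable (F k)) ->
  exists N : T -> \bar R, [/\ random_index N,
    forall w k, N w = k%:R%:E -> F k w &
    forall w k, F k w -> (N w < +oo)%E].
Proof.
move=> mF.
pose N w : \bar R := if pselect (exists k, `[< F k w >]) is left ex
  then (ex_minn ex)%:R%:E else +oo%E.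
have Nnat w k : N w = k%:R%:E -> F k w /\ forall j, F j w -> (k <= j)%N.
  rewrite /N; case: pselect => // ex; case: ex_minnP => m /asboolP Fm mmin [].
  move=> /eqP; rewrite eqr_nat => /eqP <-; split=> // j Fj.
  by apply: mmin; exact/asboolP.
have Nfin w j : F j w -> exists k : nat, N w = k%:R%:E.
  move=> Fj; rewrite /N; case: pselect => [ex|]; first by eexists.
  by case; exists j; exact/asboolP.
have Npinfty w : N w = +oo%E \/ exists k : nat, N w = k%:R%:E.
  have [[j /Nfin]|nF] := pselect (exists j, F j w); first by right.
  left; rewrite /N; case: pselect => // ex; exfalso; apply: nF.
  by case: ex => j /asboolP; exists j.
exists N; split; last 2 first.
- by move=> w k /Nnat[].
- by move=> w k /Nfin[j ->]; rewrite ltry.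
split=> // _ B mB; rewrite setTI.
have preE k : N @^-1` [set k%:R%:E] = seqDU F k.
  rewrite /seqDU -bigcup_mkord; apply/seteqP; split=> w /=.
    move=> /Nnat[Fk kmin]; split=> // -[j /= jk /kmin].
    by rewrite leqNgt jk.
  move=> [Fk nF]; have [j Nj] := Nfin _ _ Fk; have [Fj jmin] := Nnat _ _ Nj.
  rewrite Nj; have := jmin _ Fk; rewrite leq_eqVlt => /predU1P[->//|jk].
  by exfalso; apply: nF; exists j.
have -> : N @^-1` B = \bigcup_(k in [set k | B k%:R%:E]) seqDU F k `|`
    (if `[< B +oo%E >] then ~` \bigcup_k F k else set0).
  apply/seteqP; split=> w /=.
    case: (Npinfty w) => [Nw|[k Nk]].
      rewrite Nw => Boo; right; rewrite asboolT// => -[k _ /Nfin[j]].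
      by rewrite Nw.
    by rewrite Nk => Bk; left; exists k => //; rewrite -preE.
  move=> [[k Bk]|]; first by rewrite -preE /= => ->.
  case: asboolP => // Boo nF; case: (Npinfty w) => [->//|[k /Nnat[Fk _]]].
  by exfalso; apply: nF; exists k.
apply: measurableU.
  apply: bigcup_measurable => k _; apply: measurableD => //.
  exact: bigsetU_measurable.
case: ifP => // _; apply: measurableC; exact: bigcup_measurable.
Qed.

(** * Consequences of the noise density *)

Lemma density_ae_bounded d (T : measurableType d) (R : realType)
    (P : probability T R) (X : {RV P >-> R}) (phi : R -> R) :
  is_density X phi -> (forall x, x \notin `[-1, 1] -> phi x = 0) ->
  {ae P, forall w, -1 <= X w <= 1}.
Proof.
move=> [mphi phi0 Xphi] phi_out.
exists (X @^-1` (~` `[-1, 1])); split.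
- by rewrite -[X in measurable X]setTI; apply: measurable_funP => //; exact: measurableC.
- have := Xphi (~` `[-1, 1]%classic) (measurableC (measurable_itv _)).
  rewrite integral0_eq => [//|x /= xout]; rewrite phi_out//.
  exact/negP.
- by move=> w /=; rewrite in_itv.
Qed.

(** A null tail would force [phi] to vanish almost everywhere on []1/2, 1]], a set of Lebesgue
    measure 1/2 on which it is positive. *)
Lemma density_tail_gt0 d (T : measurableType d) (R : realType)
    (P : probability T R) (X : {RV P >-> R}) (phi : R -> R) :
  is_density X phi -> (forall x, x \in `[-1, 1] -> 0 < phi x) ->
  (0 < distribution P X `](1 / 2)%R, +oo[)%E.
Proof.
move=> [mphi phi0 Xphi] phi_in.
rewrite lt0e measure_ge0 andbT; apply/eqP => tail0.
have mD : measurable (`]1 / 2, 1]%classic : set R) by exact: measurable_itv.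
have mphiD : measurable_fun (`]1 / 2, 1]%classic : set R) (EFin \o phi).
  by apply/measurable_EFinP; apply: measurable_funS mphi.
have D0 : (\int[lebesgue_measure]_(x in `](1 / 2)%R, 1%R]) `|(phi x)%:E| = 0)%E.
  transitivity (\int[lebesgue_measure]_(x in `](1 / 2)%R, 1%R]) (phi x)%:E)%E.
    by apply: eq_integral => x _; rewrite /= ger0_norm.
  rewrite -Xphi//; apply/eqP; rewrite eq_le measure_ge0 andbT -tail0.
  apply: le_measure; rewrite ?inE//.
  by move=> x /=; rewrite !in_itv /= => /andP[->].
have [A [mA A0 subA]] := (ae_eq_integral_abs lebesgue_measure mD mphiD).1 D0.
suff : (lebesgue_measure (`](1 / 2)%R, 1%R]%classic : set R) <= 0)%E.
  rewrite lebesgue_measure_itv /= lte_fin ifT; last by lra.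
  by rewrite -EFinB lee_fin; lra.
rewrite -A0; apply: le_measure; rewrite ?inE//.
move=> x /= xD; apply: subA => /= /(_ xD) [phix].
move: xD; rewrite in_itv /= => /andP[x_gt x_le].
have : 0 < phi x by apply: phi_in; rewrite in_itv /=; lra.
by rewrite phix ltxx.
Qed.

(** * Limits, joint laws and measurability of the orbit *)

Lemma limn_esup_le_near (R : realType) (u : nat -> \bar R) (y : \bar R) (N : nat) :
  (forall n, (N <= n)%N -> (u n <= y)%E) -> (limn_esup u <= y)%E.
Proof.
move=> uy; apply: ge_ereal_inf.
exists (ereal_sup [set u n | n in [set n | (N <= n)%N]]).
  by exists [set n | (N <= n)%N] => //; exact: nbhs_infty_ge.
by apply: ge_ereal_sup => _ [n /= Nn <-]; exact: uy.
Qed.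

Lemma limn_einf_ge_near (R : realType) (u : nat -> \bar R) (y : \bar R) (N : nat) :
  (forall n, (N <= n)%N -> (y <= u n)%E) -> (y <= limn_einf u)%E.
Proof.
move=> uy; rewrite leeNr; apply: (@limn_esup_le_near _ _ _ N) => n Nn.
by rewrite leeN2 uy.
Qed.

Lemma iid_cap d (T : measurableType d) (R : realType) (P : probability T R)
    (X : nat -> {RV P >-> R}) (B : set R) :
  mutually_independent X -> identically_distributed X -> measurable B ->
  forall J : seq nat, uniq J ->
  P (\bigcap_(i in [set` J]) X i @^-1` B) =
  (fine (distribution P (X 0%N) B) ^+ size J)%:E.
Proof.
move=> indX idX mB J uJ; rewrite (indX J (fun=> B) uJ)//.
have PX i : P (X i @^-1` B) = (fine (distribution P (X 0%N) B))%:E.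
  rewrite fineK; last exact: fin_num_measure.
  exact: (idX i 0%N).
elim: J {uJ} => [|i J ih]; first by rewrite big_nil.
by rewrite big_cons ih PX -EFinM exprS.
Qed.

Lemma orbit_measurable d (T : measurableType d) (R : realType)
    (f : R -> R) (nu l : R) (e : nat -> T -> R) (x : nat -> T -> R) :
  {within `[0, +oo[, continuous f} -> 0 <= nu ->
  (forall n, measurable_fun setT (e n)) -> measurable_fun setT (x 0%N) ->
  (forall n w, 0 <= x n w) ->
  (forall n w, x n.+1 w = Num.max (f (nu * x n w) + l * e n.+1 w) 0) ->
  forall n, measurable_fun setT (x n).
Proof.
move=> fc nu0 me mx0 x_ge0 xS; elim=> // n ih.
rewrite (_ : x n.+1 = (f \o (fun w => nu * x n w) \+ (fun w => l * e n.+1 w))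
  \max cst 0); last by apply/funext => w; rewrite xS.
apply: measurable_maxr; last exact: measurable_cst.
apply: measurable_funD; last exact: measurable_funM.
(* [f] is controlled on [[0, +oo[] only, so the composition goes through this subspace, which
   contains all values [nu * x n w]. *)
apply: (@measurable_comp _ _ _ _ _ _ (`[0, +oo[%classic : set R)).
- exact: measurable_itv.
- by move=> _ [w _ <-]; rewrite /= in_itv /= andbT mulr_ge0.
- by apply: subspace_continuous_measurable_fun => //; exact: measurable_itv.
- exact: measurable_funM.
Qed.

(** By continuity from below, [P (F k)] tends to the probability of the union, which is 1; if no
    [P (F k)] exceeded [gamma], the limit would not either. *)
Lemma probability_eventually d (T : measurableType d) (R : realType)
    (P : probability T R) (F : nat -> set T) (gamma : R) :
  (forall k, measurable (F k)) ->
  (forall k m, (k <= m)%N -> F k `<=` F m) ->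
  {ae P, forall w, exists k, F k w} -> gamma < 1 ->
  exists k, (gamma%:E < P (F k))%E.
Proof.
move=> mF incF aeF g1; apply/not_existsP => nF.
have mU : measurable (\bigcup_k F k) by exact: bigcup_measurable.
have PU : P (\bigcup_k F k) = 1%E.
  rewrite -[X in P X]setCK probability_setC; last exact: measurableC.
  suff -> : P (~` \bigcup_k F k) = 0%E by rewrite sube0.
  apply: measure_negligible; first exact: measurableC.
  apply: negligibleS aeF => w nU [k Fk]; apply: nU; by exists k.
have cv : (P \o F) k @[k --> \oo] --> P (\bigcup_k F k).
  by apply: nondecreasing_cvg_mu => // k m km; apply/subsetPset/incF.
have : (P (\bigcup_k F k) <= gamma%:E)%E.
  rewrite -(cvg_lim _ cv)//; apply: lime_le; first by apply/cvg_ex; eexists; exact: cv.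
  by apply: nearW => k; rewrite leNgt; apply/negP/nF.
by rewrite PU lee_fin leNgt g1.
Qed.

(** * From pathwise trapping to the three conclusions *)

Theorem theorem4p7 (R : realType) (f : R -> R) (b : R)
    (hf : map_assumption f b)
    (disp : measure_display) (T : measurableType disp) (P : probability T R)
    (chi : nat -> {RV P >-> R}) (hchi : noise_assumption (fun n => chi n.+1))
    (xs : R) (hxs : xs \in `]f 0, f b[) :
  let nu := Phi f (inv_on f b xs) in
  let g := fun x : R => f (nu * x) in
  let c := b / nu in
  forall (d : R), 0 < d ->
    d < Num.min (c - g c) (max_over (fun x => g x - x) 0 xs) ->
  let y1 := sup [set x | x \in `[0, xs] /\ d <= g x - x] in
  let y2 := inf [set x | x \in `[xs, c] /\ g x - x <= - d] in
  forall (l : R), 0 < l -> l <= d ->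
  forall (x0 : R), 0 < x0 ->
  forall (x : nat -> T -> R),
    (forall w, x 0%N w = x0) ->
    (forall n w, x n.+1 w = Num.max (f (nu * x n w) + l * chi n.+1 w) 0) ->
  [/\ forall eps : R, 0 < eps ->
        exists N : T -> \bar R,
          [/\ random_index N,
              {ae P, forall w, (N w < +oo)%E} &
              {ae P, forall w, forall n : nat, (N w <= n%:R%:E)%E ->
                 y1 <= x n w <= y2 + eps}],
      forall eps gamma : R, 0 < eps -> 0 < gamma < 1 ->
        exists N : nat,
          (gamma%:E < P [set w | forall n : nat, (N <= n)%N ->
                                   (y1 <= x n w <= y2 + eps)%R])%E &
      {ae P, forall w, (y1%:E <= limn_einf (fun n => (x n w)%:E))%E} /\
      {ae P, forall w, (limn_esup (fun n => (x n w)%:E) <= y2%:E)%E}].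
Proof.
move=> nu g c d d0; rewrite lt_min => /andP[dc dM] y1 y2 l l0 ld x0 x0_gt0 x x_init xS.
have [nu0 hg] := rescaled_mapP hf hxs; rewrite -/nu in nu0 hg.
have [_ chi_indep chi_id _ [phi [chi_dens phi_in phi_out]]] := hchi.
have x_ge0 n w : 0 <= x n w.
  by case: n => [|n]; rewrite ?x_init ?xS ?le_max ?lexx ?orbT// ltW.
have mx n : measurable_fun setT (x n).
  apply: (orbit_measurable (e := fun n => chi n) (map_continuous hf) (ltW nu0)
    _ _ x_ge0 xS).
  - by move=> k; exact: measurable_funPT.
  - by rewrite (_ : x 0%N = cst x0)//; apply/funext.
(* Enough gains of [l / 2] to climb from 0 to [y1]. *)
pose K := (Num.trunc (y1 / (l / 2))).+1.
have y1K : y1 <= K%:R * (l / 2).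
  by rewrite -ler_pdivrMr ?divr_gt0// ltW// truncnS_gt.
have runs : {ae P, forall w, forall m, exists2 j, (m <= j)%N &
    forall i, (i < K)%N -> 1 / 2 < chi (j + i).+1 w}.
  have mB : measurable (`]1 / 2, +oo[%classic : set R) by exact: measurable_itv.
  have mH i : measurable (chi i.+1 @^-1` `]1 / 2, +oo[).
    by rewrite -[X in measurable X]setTI; exact: measurable_funP.
  have := ae_runs K mH _ (iid_cap chi_indep chi_id mB).
  rewrite fine_gt0; last first.
    by rewrite (density_tail_gt0 (chi_dens 0%N) phi_in) ltey_eq fin_num_measure.
  move=> /(_ isT); apply: filterS => w run m; have [j mj hj] := run m.
  by exists j => // i /hj; rewrite /= in_itv /= andbT.
have bounded : {ae P, forall w, forall n, -1 <= chi n.+1 w <= 1}.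
  apply: ae_foralln => n; exact: density_ae_bounded (chi_dens n) phi_out.
(* All three conclusions follow from this. As [eps] is quantified inside the event, a single null
   set serves every [eps]. *)
have trapped : {ae P, forall w, forall eps, 0 < eps ->
    exists N, forall n, (N <= n)%N -> y1 <= x n w <= y2 + eps}.
  apply: filterS2 runs bounded => w run bnd.
  exact: (orbit_trapped (e := fun n => chi n w) hg d0 dc dM l0 ld
    (fun n => x_ge0 n w) (fun n => xS n w) bnd y1K run).
pose F eps N := [set w | forall n, (N <= n)%N -> y1 <= x n w <= y2 + eps].
have mF eps N : measurable (F eps N).
  rewrite (_ : F eps N = \bigcap_(n in [set n | (N <= n)%N])
      x n @^-1` `[y1, y2 + eps]); last first.
    by apply/seteqP; split=> w /= h n /h; rewrite /= in_itv.
  apply: bigcap_measurable => [|n _]; first by exists N => /=.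
  by rewrite -[X in measurable X]setTI; apply: mx => //; exact: measurable_itv.
split.
- move=> eps eps0; have [N [rN NF FN]] := random_index_exists R (mF eps).
  exists N; split=> //.
    by apply: filterS trapped => w /(_ _ eps0)[k]; exact: FN.
  (* The bound holds for every [w]: where [N w = +oo], no [n] satisfies the premise. *)
  apply: aeW => w n; case: rN => _ /(_ w)[->|[k Nk]]; first by rewrite leye_eq.
  by rewrite Nk lee_fin ler_nat; exact: (NF _ _ Nk).
- move=> eps gamma eps0 /andP[_ gamma1].
  apply: (probability_eventually (mF eps)) => //.
    by move=> k m km w Fk n mn; exact/Fk/(leq_trans km).
  by apply: filterS trapped => w; apply.
- split.
    (* The lower bound does not involve [eps], so the value 1 suffices; the upper limit below lets
       [eps] be arbitrary. *)
    apply: filterS trapped => w /(_ 1 ltr01)[N hN].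
    apply: (@limn_einf_ge_near _ _ _ N) => n /hN /andP[].
    by rewrite lee_fin.
  apply: filterS trapped => w hw; apply/lee_addgt0Pr => eps /hw[N hN].
  apply: (@limn_esup_le_near _ _ _ N) => n /hN /andP[_].
  by rewrite -EFinD lee_fin.
Qed.
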